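(* Let $\nu>0$, $0<T<\infty$, and let $u$ be a Leray-Hopf solution on $[0,T]$ of the 3D Navier-Stokes equations $\partial_t u-\nu\Delta u+(u\cdot\nabla)u+\nabla p=0$, $\nabla\cdot u=0$ on $\mathbb{R}^3$. If $u\in L^r((0,T);B^{2/r-1}_{\infty,\infty})$ for some $1\le r<\infty$, then $f\in L^1(0,T)$, where $$f(t)=\|u_{\le Q(t)}(t)\|_{B^1_{\infty,\infty}}=\sup_{q\le Q(t)}\lambda_q\|u_q(t)\|_\infty$$ and $Q(t)$ is defined in the context.
   Context: Weak solution: for divergence-free $u_0\in L^2(\mathbb{R}^3)$, a weak solution on $[0,T]$ with initial data $u_0$ is a vector field $u\in C_{\mathrm w}([0,T];L^2(\mathbb{R}^3))$ (weakly continuous in time) with $u(0)=u_0$, $\nabla_x\cdot u(t)=0$ in the sense of distributions for all $t\in[0,T]$, and $$(u(t),\varphi(t))-(u_0,\varphi(0))=\int_0^t\{(u(s),\partial_s\varphi(s))+\nu(u(s),\Delta\varphi(s))+(u(s)\cdot\nabla\varphi(s),u(s))\}\,ds$$ for all $t\in[0,T]$ and all vector-valued test functions $\varphi\in C_0^\infty([0,T]\times\mathbb{R}^3)$ with $\nabla_x\cdot\varphi=0$, where $(\cdot,\cdot)$ is the $L^2$ inner product. Leray-Hopf solution ($\nu>0$): a weak solution with $u\in L^2([0,T];H^1(\mathbb{R}^3))$ satisfying $\|u(t)\|_2^2+2\nu\int_{t_0}^t\|\nabla u(s)\|_2^2\,ds\le\|u(t_0)\|_2^2$ for almost all $t_0\in(0,T)$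 and all $t\in(t_0,T]$. Littlewood-Paley notation: $\lambda_q=2^q$. Fix a nonnegative radial $\chi\in C_0^\infty(B_1)$, $B_1\subset\mathbb{R}^3$ the unit ball centered at $0$, with $\chi(\xi)=1$ for $|\xi|\le 1/2$; $\varphi(\xi)=\chi(\xi/2)-\chi(\xi)$, $\varphi_q(\xi)=\varphi(2^{-q}\xi)$. For a tempered distribution $u$: $u_q=\mathcal F^{-1}(\varphi_q)*u$ for $q\ge0$, $u_{-1}=\mathcal F^{-1}(\chi)*u$, so $u=\sum_{q\ge-1}u_q$; and $u_{\le Q}=\sum_{-1\le q\le Q}u_q$. Besov norm: $\|u\|_{B^s_{p,\infty}}=\sup_{q\ge-1}\lambda_q^s\|u_q\|_{L^p}$. The two expressions for $f$ are identified (they agree up to absolute multiplicative constants); take $f(t)=\sup_{-1\le q\le Q(t)}\lambda_q\|u_q(t)\|_\infty$ as its definition. Dissipation wavenumber: with $c_0>0$ a fixed absolute constant, $\Lambda(t)=\min\{\lambda_q:\ q\ge0,\ \lambda_p^{-1}\|u_p(t)\|_\infty<c_0\nu\ \text{ for all } p>q\}$, with $\Lambda(t)=\infty$ if no such $q$ exists, and $Q(t)$ is defined by $\lambda_{Q(t)}=\Lambda(t)$. *)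

(* Defs.v *)
From mathcomp Require Import all_boot all_order all_algebra.
From mathcomp Require Import all_classical all_reals all_analysis.
From mathcomp Require Import complex.
Set Implicit Arguments.
Unset Strict Implicit.
Unset Printing Implicit Defensive.
Import Order.TTheory GRing.Theory Num.Theory.
Import numFieldNormedType.Exports.
Local Open Scope classical_set_scope.
Local Open Scope ring_scope.

(* R^3 is the triple product R * R * R, which carries the product topology, the
   Borel sigma-algebra and the product Lebesgue measure. The library norm on a
   product is the max norm, so the Euclidean norm is defined separately. *)
Notation space3 R := (R * R * R)%type.

(* The same type with the sigma-algebra on which lebesgue_measure is declared: it
   is convertible to the one inferred for space3 R, but has another display. *)
Notation mspace3 R :=
  (measurableTypeR R * measurableTypeR R * measurableTypeR R)%type.

(* A vector field on R^3, given by its components. Fields in L^2 are represented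
   by measurable functions, identified when equal almost everywhere. *)
Definition vfield (R : realType) := 'I_3 -> space3 R -> R.

Section Euclidean.
Context {R : realType}.

Definition leb3 : {measure set (mspace3 R) -> \bar R} :=
  ((@lebesgue_measure R \x @lebesgue_measure R) \x @lebesgue_measure R)%E.

Definition dot (x y : space3 R) : R :=
  x.1.1 * y.1.1 + x.1.2 * y.1.2 + x.2 * y.2.

Definition enorm (x : space3 R) : R := Num.sqrt (dot x x).

Definition unit_vec (j : 'I_3) : space3 R :=
  ((j == 0%N :> nat)%:R, (j == 1%N :> nat)%:R, (j == 2%N :> nat)%:R).

Definition partial (j : 'I_3) (g : space3 R -> R) (x : space3 R) : R :=
  'D_(unit_vec j) g x.

Definition laplacian (g : space3 R -> R) (x : space3 R) : R :=
  \sum_(j < 3) partial j (partial j g) x.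

Definition divergence (v : vfield R) (x : space3 R) : R :=
  \sum_(i < 3) partial i (v i) x.

Definition vnorm (v : vfield R) (x : space3 R) : R :=
  Num.sqrt (\sum_(i < 3) v i x ^+ 2).

Definition mnorm (G : 'I_3 -> vfield R) (x : space3 R) : R :=
  Num.sqrt (\sum_(i < 3) \sum_(j < 3) G i j x ^+ 2).

Definition Lp_norm (p : \bar R) (g : space3 R -> R) : \bar R :=
  Lnorm leb3 p (EFin \o g).

Definition in_L2 (v : vfield R) : Prop :=
  (forall i, measurable_fun [set: mspace3 R] (v i)) /\
  (Lp_norm 2%:E (vnorm v) < +oo)%E.

Definition inner (v w : vfield R) : R :=
  \int[leb3]_x (\sum_(i < 3) v i x * w i x).

End Euclidean.

Section TestFunctions.
Context {R : realType} {V : normedModType R}.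

(* In finite dimension, existence and continuity of all iterated directional
   derivatives of order at most k is the usual class C^k. *)
Fixpoint Ck (k : nat) (g : V -> R) : Prop :=
  continuous g /\
  if k is k'.+1 then
    forall v : V, (forall x, derivable g x v) /\ Ck k' (fun x => 'D_v g x)
  else True.

Definition smooth (g : V -> R) : Prop := forall k, Ck k g.

Definition supp (g : V -> R) : set V := closure [set x | g x != 0].

Definition test_function (g : V -> R) : Prop := smooth g /\ compact (supp g).

End TestFunctions.

Section WeakSolutions.
Context {R : realType}.
Implicit Types (u : R -> vfield R) (v : vfield R) (T nu : R).

Definition div_free v : Prop :=
  forall psi : space3 R -> R, test_function psi ->
    \int[leb3]_x (\sum_(i < 3) v i x * partial i psi x) = 0.

Definition weak_gradient v (G : 'I_3 -> vfield R) : Prop :=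
  forall (i j : 'I_3) (psi : space3 R -> R), test_function psi ->
    \int[leb3]_x (v i x * partial j psi x) = - \int[leb3]_x (G i j x * psi x).

Definition slice (phi : 'I_3 -> R * space3 R -> R) (s : R) : vfield R :=
  fun i x => phi i (s, x).

Definition dt (phi : 'I_3 -> R * space3 R -> R) (s : R) : vfield R :=
  fun i x => 'D_1 (fun s' : R => phi i (s', x)) s.

(* Test fields in C_0^oo([0,T] x R^3) are the restrictions to [0,T] x R^3 of the
   smooth compactly supported fields on R x R^3; only the values on [0,T] x R^3
   matter, so the divergence is constrained there only. *)
Definition test_field T (phi : 'I_3 -> R * space3 R -> R) : Prop :=
  (forall i, test_function (phi i)) /\
  (forall s, s \in `[0, T] -> forall x, divergence (slice phi s) x = 0).

(* The field (v . nabla) w. *)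
Definition advect v (w : vfield R) : vfield R :=
  fun i x => \sum_(j < 3) v j x * partial j (w i) x.

Definition weakly_continuous T u : Prop :=
  forall w, in_L2 w -> {within `[0, T], continuous (fun t => inner (u t) w)}.

Definition weak_solution nu T (u0 : vfield R) u : Prop :=
  [/\ in_L2 u0 /\ div_free u0,
      (forall t, t \in `[0, T] -> in_L2 (u t)) /\ weakly_continuous T u,
      {ae leb3, forall x, forall i, u 0 i x = u0 i x},
      forall t, t \in `[0, T] -> div_free (u t) &
      forall phi, test_field T phi -> forall t, t \in `[0, T] ->
        inner (u t) (slice phi t) - inner u0 (slice phi 0) =
        \int[lebesgue_measure]_(s in `[0, t])
          (inner (u s) (dt phi s)
           + nu * inner (u s) (fun i => laplacian (slice phi s i))
           + inner (advect (u s) (slice phi s)) (u s))].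

(* The field G is the spatial gradient of u. Up to null sets it is determined by
   u, and strong measurability of u as a function of time with values in H^1
   follows from weak continuity in L^2, so that membership in L^2(0,T; H^1) is
   the square-integrability of the H^1 norm. *)
Definition leray_hopf nu T (u0 : vfield R) u : Prop :=
  weak_solution nu T u0 u /\
  exists G : R -> 'I_3 -> vfield R,
    [/\ {ae lebesgue_measure, forall t : R, t \in `]0, T[ ->
          weak_gradient (u t) (G t) /\ forall i, in_L2 (G t i)},
        lebesgue_measure.-integrable `[0, T]
          (fun t => Lp_norm 2%:E (vnorm (u t)) ^+ 2
                    + Lp_norm 2%:E (mnorm (G t)) ^+ 2)%E &
        {ae lebesgue_measure, forall t0 : R, t0 \in `]0, T[ ->
          forall t, t \in `]t0, T] ->
          (Lp_norm 2%:E (vnorm (u t)) ^+ 2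
           + (2 * nu)%:E *
             \int[lebesgue_measure]_(s in `[t0, t])
               (Lp_norm 2%:E (mnorm (G s)) ^+ 2)
           <= Lp_norm 2%:E (vnorm (u t0)) ^+ 2)%E}].

End WeakSolutions.

Section LittlewoodPaley.
Context {R : realType}.
Implicit Types (chi : space3 R -> R) (v : vfield R) (q : int).

Definition cutoff chi : Prop :=
  [/\ test_function chi /\ supp chi `<=` [set xi | enorm xi < 1],
      forall xi, 0 <= chi xi,
      forall xi eta, enorm xi = enorm eta -> chi xi = chi eta &
      forall xi, enorm xi <= 1 / 2 -> chi xi = 1].

Definition lambda q : R := 2 ^ q.

(* chi for q = -1 and phi_q for q >= 0; values of q below -1 are never used. *)
Definition lp_symbol chi q (xi : space3 R) : R :=
  if q == -1 then chi xi
  else chi (2^-1 *: (lambda (- q) *: xi)) - chi (lambda (- q) *: xi).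

Definition cintegral (h : space3 R -> R[i]) : R[i] :=
  ((\int[leb3]_x complex.Re (h x)) +i* (\int[leb3]_x complex.Im (h x)))%C.

(* Convention: F g (xi) = int g(x) e^(-i x.xi) dx. *)
Definition inv_fourier (g : space3 R -> R) (x : space3 R) : R[i] :=
  (((2 * pi) ^- 3)%:C *
    cintegral (fun xi => (g xi)%:C * (cos (dot xi x) +i* sin (dot xi x))))%C.

Definition convolution (h : space3 R -> R[i]) (g : space3 R -> R)
    (x : space3 R) : R[i] :=
  cintegral (fun y => h (x - y) * (g y)%:C)%C.

(* The block v_q, a priori complex valued. *)
Definition lp_block chi q v (i : 'I_3) : space3 R -> R[i] :=
  convolution (inv_fourier (lp_symbol chi q)) (v i).

Definition block_norm chi q (p : \bar R) v : \bar R :=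
  Lp_norm p (fun x => Num.sqrt (\sum_(i < 3)
    (complex.Re (lp_block chi q v i x) ^+ 2
     + complex.Im (lp_block chi q v i x) ^+ 2))).

(* The norm of B^s_{p,oo}. *)
Definition besov_norm chi (s : R) (p : \bar R) v : \bar R :=
  ereal_sup [set ((lambda q `^ s)%:E * block_norm chi q p v)%E
            | q in [set q | -1 <= q]].

(* The infimum of a nonempty subset of {2^q : q >= 0} is attained, and the
   infimum of the empty set is +oo. *)
Definition wavenumber chi (c0 nu : R) v : \bar R :=
  ereal_inf [set (lambda q)%:E | q in [set q | 0 <= q /\
    forall p : int, q < p ->
      ((lambda p)^-1%:E * block_norm chi p +oo v < (c0 * nu)%:E)%E]].

(* Q = log_2 Lambda, with Q = +oo when Lambda = +oo. *)
Definition wave_index chi (c0 nu : R) v : \bar R :=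
  ((ln 2)^-1%:E * lne (wavenumber chi c0 nu v))%E.

Definition low_mode_norm chi (c0 nu : R) v : \bar R :=
  ereal_sup [set ((lambda q)%:E * block_norm chi q +oo v)%E
            | q in [set q | -1 <= q /\
                            (q%:~R%:E <= wave_index chi c0 nu v)%E]].

End LittlewoodPaley.

(* Main.v *)
From HB Require Import structures.
Require Import Defs.
From mathcomp Require Import all_boot all_order all_algebra.
From mathcomp Require Import all_classical all_reals all_analysis.
From mathcomp Require Import measurable_realfun ess_sup_inf complex.
From mathcomp Require Import zify ring.
Import Order.TTheory GRing.Theory Num.Theory.
Import numFieldNormedType.Exports.
Local Open Scope classical_set_scope.
Local Open Scope ring_scope.

Set Implicit Arguments.
Unset Strict Implicit.

(** Let [A(t)] be the norm of [u(t)] in [B^(2/r-1)_(oo,oo)]. For every [q] one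
    has [lambda_q ||u_q|| <= lambda_q^(2-2/r) A]. If [1 <= q <= Q(t)], then
    [q - 1] violates the condition defining [Lambda], so for some [p >= q]
    [c0 nu <= lambda_p^-1 ||u_p|| <= lambda_p^(-2/r) A <= lambda_q^(-2/r) A];
    raising to the power [r - 1] gives [lambda_q^(2-2/r) <= (A / (c0 nu))^(r-1)],
    and so [f <= 1 + (1 + (c0 nu)^(1-r)) A^r] at every time.

    The remaining issue is the Borel measurability of [f]. The kernel of a
    Littlewood-Paley block is the Fourier transform of a smooth compactly
    supported symbol; one integration by parts in each variable bounds its square
    by a constant times the product of the [1 / (1 + x_i^2)], so it is in [L^2].
    By weak continuity [u_q(t, x)] is then continuous in [t] for each fixed [x],
    and since a countable union of null sets is null, the sublevel sets of
    [t |-> ||u_q(t)||_oo] are relatively closed in [(0, T)]. *)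

(** * Measurability of the sup norm in a parameter *)

(** Superlevel sets in [D] are open: along a sequence of times tending to t, the bound [a] holds
    outside one common null set, and continuity in t at each fixed point carries it to the limit. *)
Lemma measurable_fun_Lnorm_pinfty d (X : measurableType d) (R : realType)
    (mu : {measure set X -> \bar R}) (D : set R) (F : R -> X -> R) :
  open D -> (forall x t, D t -> {for t, continuous (F ^~ x)}) ->
  measurable_fun D (fun t => Lnorm mu +oo (EFin \o F t) : \bar R).
Proof.
move=> oD cF; under eq_fun do rewrite unlock.
(* On a space of measure zero the norm is constant by convention; otherwise it is the essential
   supremum. *)
case: (0 < mu [set: X])%E; last exact: measurable_cst.
move=> mD; apply: (measurability _ (ErealGenOInfty.measurableE R)).
move=> /= _ [_ [a ->]] <-; apply: open_measurable.
rewrite preimage_itvoy openE => t [Dt /= at_].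
rewrite /interior/=; apply: contrapT => nt.
(* If t is not interior to the superlevel set, each ball of radius 1/(n+1) around t meets [D] at a
   time where the essential supremum is at most [a]. *)
have /choice[s s_spec] : forall n : nat, exists z : R, [/\ ball t n.+1%:R^-1 z, D z &
    (ess_sup mu (abse \o (EFin \o F z)) <= a%:E)%E].
  move=> n; apply: contrapT => ns; apply: nt.
  have Dn : nbhs t D by exact: open_nbhs_nbhs.
  apply: filterS2 Dn (nbhsx_ballx t n.+1%:R^-1 _) => // z Dz zt; split=> //=.
  rewrite ltNge; apply/negP => az; apply: ns; by exists z.
have st : s n @[n --> \oo] --> t.
  apply/cvgrPdist_lt => e e0; near=> n.
  have [+ _ _] := s_spec n; rewrite /ball/= => /lt_trans; apply.
  near: n; exact: near_infty_natSinv_lt (PosNum e0).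
have : (ess_sup mu (abse \o (EFin \o F t)) <= a%:E)%E.
  apply/ess_supP.
  have : {ae mu, forall x, forall n, `|F (s n) x| <= a}.
    apply/ae_foralln => n; have [_ _ /ess_supP] := s_spec n.
    by apply: filterS => x /=.
  apply: filterS => x Fx /=; rewrite lee_fin.
  have /cvg_norm/= Ft : F (s n) x @[n --> \oo] --> F t x.
    exact: (cvg_comp _ _ st (cF x t Dt)).
  rewrite -(cvg_lim _ Ft)//; apply: limr_le; first by apply: cvgP Ft.
  by near=> n; exact: Fx.
by rewrite leNgt at_.
Unshelve. all: by end_near. Qed.

(** * Low modes and the dissipation wavenumber *)

(** The index set may vary with the point, as it does for [wavenumber] and [low_mode_norm]. A
    superlevel set is the countable union over i of the points where i is admissible and [g i]
    exceeds the level. *)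
Lemma measurable_fun_ereal_sup d (X : measurableType d) (R : realType) (I : Type)
    (D : set X) (P : X -> set I) (g : I -> X -> \bar R) :
  countable [set: I] ->
  (forall i, measurable (D `&` [set x | P x i])) ->
  (forall i, measurable_fun (D `&` [set x | P x i]) (g i)) ->
  measurable_fun D (fun x => ereal_sup [set g i x | i in P x]).
Proof.
move=> cI mP mg mD; apply: (measurability _ (ErealGenOInfty.measurableE R)) => //.
move=> /= _ [_ [a ->]] <-.
rewrite [X in measurable X](_ : _ = \bigcup_(i : I)
   ((D `&` [set x | P x i]) `&` [set x | (a%:E < g i x)%E])).
  apply: countable_bigcupT_measurable => // i.
  by apply: emeasurable_fun_o_infty => //; exact: mg.
apply/seteqP; split => [x [Dx] /=|x [i _ [[Dx Pi] ai]]].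
  rewrite in_itv/= andbT => /ereal_sup_gt[_ [i Pi <-] ai].
  by exists i.
split => //=; rewrite in_itv/= andbT; apply/ereal_sup_gtP.
by exists (g i x) => //; exists i.
Qed.

Lemma measurable_fun_ereal_inf d (X : measurableType d) (R : realType) (I : Type)
    (D : set X) (P : X -> set I) (g : I -> X -> \bar R) :
  countable [set: I] ->
  (forall i, measurable (D `&` [set x | P x i])) ->
  (forall i, measurable_fun (D `&` [set x | P x i]) (g i)) ->
  measurable_fun D (fun x => ereal_inf [set g i x | i in P x]).
Proof.
move=> cI mP mg; under eq_fun => x do rewrite ereal_infEN image_comp.
apply: (measurableT_comp (@oppe_measurable _ setT)).
apply: measurable_fun_ereal_sup => // i.
exact: (measurableT_comp (@oppe_measurable _ setT)).
Qed.

Section low_modes.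
Context {R : realType}.
Implicit Types (chi : space3 R -> R) (v : vfield R) (q : int).

Lemma lambda_gt0 q : 0 < lambda q :> R.
Proof. by rewrite exprz_gt0. Qed.

Lemma lambda_ge0 q : 0 <= lambda q :> R.
Proof. exact/ltW/lambda_gt0. Qed.

Lemma ler_lambda q q' : (lambda q <= lambda q' :> R) = (q <= q').
Proof. by rewrite ler_eXz2l// ltr1n. Qed.

Lemma powR_lambda q (s : R) : lambda q `^ s = 2 `^ (q%:~R * s).
Proof. by rewrite powRrM powR_intmul. Qed.

Lemma block_norm_ge0 chi q p v : (0 <= block_norm chi q p v)%E.
Proof. exact: Lnorm_ge0. Qed.

Lemma besov_norm_ge0 chi s p v : (0 <= besov_norm chi s p v)%E.
Proof.
apply: ereal_sup_ge; exists ((lambda 0 `^ s)%:E * block_norm chi 0 p v)%E.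
  by exists 0.
by rewrite mule_ge0 ?block_norm_ge0// lee_fin powR_ge0.
Qed.

Lemma wavenumber_ge1 chi c0 nu v : (1 <= wavenumber chi c0 nu v)%E.
Proof.
apply/ereal_infP => _ [q [q0 _] <-].
by rewrite lee_fin (_ : 1 = lambda 0) ?ler_lambda// /lambda expr0z.
Qed.

(** The base 2 logarithm is monotone on the values of [wavenumber], which are at least 1 and
    possibly infinite. From here on Q is replaced by comparisons of powers of 2 with Lambda. *)
Lemma le_wave_index chi c0 nu v q :
  (q%:~R%:E <= wave_index chi c0 nu v)%E =
  ((lambda q)%:E <= wavenumber chi c0 nu v)%E.
Proof.
have ln2 : 0 < ln 2 :> R by rewrite ln_gt0// ltr1n.
rewrite /wave_index; move: (wavenumber_ge1 chi c0 nu v).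
case: wavenumber => [w| |//].
- rewrite lee_fin => w1; have w0 : 0 < w by exact: lt_le_trans w1.
  rewrite lne_EFin// -EFinM !lee_fin mulrC ler_pdivlMr//.
  rewrite -ln_powR powR_intmul ?ler0n// ler_ln ?posrE ?lambda_gt0//.
- by move=> _; rewrite /= gt0_muley ?leey// lte_fin invr_gt0.
Qed.

Lemma low_mode_norm_ge0 chi c0 nu v : (0 <= low_mode_norm chi c0 nu v)%E.
Proof.
apply: ereal_sup_ge; exists ((lambda 0)%:E * block_norm chi 0 +oo v)%E.
  exists 0 => //; split=> //; rewrite le_wave_index.
  by rewrite {1}/lambda expr0z wavenumber_ge1.
by rewrite mule_ge0 ?block_norm_ge0// lee_fin lambda_ge0.
Qed.

Lemma measurable_low_mode_norm chi c0 nu (u : R -> vfield R) (D : set R) :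
  measurable D ->
  (forall q, -1 <= q ->
    measurable_fun D (fun t => block_norm chi q +oo (u t) : \bar R)) ->
  measurable_fun D (fun t => low_mode_norm chi c0 nu (u t) : \bar R).
Proof.
move=> mD mN.
have mw : measurable_fun D (fun t => wavenumber chi c0 nu (u t) : \bar R).
  apply: (@measurable_fun_ereal_inf _ _ _ int _ (fun t => [set q | 0 <= q /\
    forall p : int, q < p ->
      ((lambda p)^-1%:E * block_norm chi p +oo (u t) < (c0 * nu)%:E)%E])
      (fun q _ => (lambda q)%:E)) => [//|q|q]; last exact: measurable_cst.
  have [q0|q0] := leP 0 q; last first.
    rewrite [X in measurable X](_ : _ = set0)//; apply/seteqP; split => // t /=.
    by move=> [_ [+ _]]; rewrite leNgt q0.
  (* Admissibility of q quantifies over all p > q; its failure is a countable union of measurable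
     conditions, one for each p. *)
  rewrite [X in measurable X](_ : _ = D `\` \bigcup_(p : int)
     (if q < p then D `&` [set t | ((c0 * nu)%:E <=
        (lambda p)^-1%:E * block_norm chi p +oo (u t))%E] else set0)).
    apply: measurableD => //; apply: countable_bigcupT_measurable => // p.
    case: ifPn => // qp; apply: emeasurable_fun_c_infty => //.
    apply: measurable_funeM; apply: mN.
    by apply: le_trans (ltW qp); apply: le_trans q0.
  apply/seteqP; split => t /=.
    move=> [Dt [_ tq]]; split=> // -[p _]; case: ifPn => // qp [_] /=.
    by rewrite leNgt tq.
  move=> [Dt tq]; split=> //; split=> // p qp; rewrite ltNge; apply/negP => tp.
  by apply: tq; exists p => //; rewrite qp.
apply: (@measurable_fun_ereal_sup _ _ _ int _ (fun t => [set q | -1 <= q /\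
    (q%:~R%:E <= wave_index chi c0 nu (u t))%E])
    (fun q t => ((lambda q)%:E * block_norm chi q +oo (u t))%E)) => [//|q|q].
  have [q1|q1] := leP (-1) q; last first.
    rewrite [X in measurable X](_ : _ = set0)//; apply/seteqP; split => // t /=.
    by move=> [_ [+ _]]; rewrite leNgt q1.
  rewrite [X in measurable X](_ : _ =
    D `&` [set t | ((lambda q)%:E <= wavenumber chi c0 nu (u t))%E]).
    exact: emeasurable_fun_c_infty.
  by apply/seteqP; split => t /= [Dt]; rewrite le_wave_index => // -[].
have [q1|q1] := leP (-1) q; last first.
  rewrite [X in measurable_fun X](_ : _ = set0).
    exact: measurable_fun_set0.
  apply/seteqP; split => // t /=.
  by move=> [_ [+ _]]; rewrite leNgt q1.
by apply: measurable_funeM; apply: measurable_funS (mN _ q1).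
Qed.

Lemma low_mode_norm_le chi c0 nu r v : 0 < c0 * nu -> 1 <= r ->
  (low_mode_norm chi c0 nu v <= 1 + (1 + (c0 * nu) `^ (1 - r))%:E *
    besov_norm chi (2 / r - 1) +oo v `^ r)%E.
Proof.
move=> k0 r1; set k := c0 * nu in k0 *; set A := besov_norm _ _ _ v.
have r0 : 0 < r by exact: lt_le_trans r1.
have K0 : 0 < 1 + k `^ (1 - r) by rewrite ltr_pwDl// powR_ge0.
have : (0 <= A)%E by exact: besov_norm_ge0.
have blockA q : -1 <= q ->
   ((lambda q `^ (2 / r - 1))%:E * block_norm chi q +oo v <= A)%E.
  by move=> q1; apply: ereal_sup_ubound; exists q.
(* When [A] is infinite so is the right-hand side, because r > 0 and the coefficient is positive. *)
case: A blockA => [a| |//] blockA; last first.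
  by move=> _; rewrite poweRyr ?gt_eqF// gt0_muley ?lte_fin// addey// leey.
rewrite lee_fin => a0; rewrite poweR_EFin -EFinM -EFinD.
have block_le q : -1 <= q ->
   (block_norm chi q +oo v <= (lambda q `^ (1 - 2 / r) * a)%:E)%E.
  move=> /blockA; move: (block_norm_ge0 chi q +oo v).
  case: (block_norm chi q +oo v) => [b| |//].
    rewrite -EFinM !lee_fin => b0.
    rewrite -(opprB (2 / r)) powRN ler_pdivlMl ?powR_gt0 ?lambda_gt0//.
  by rewrite gt0_muley ?lte_fin ?powR_gt0 ?lambda_gt0// leye_eq.
apply/ereal_supP => _ [q [q1 qw] <-].
apply: (@le_trans _ _ (lambda q `^ (2 - 2 / r) * a)%:E).
  apply: le_trans (lee_wpmul2l _ (block_le q q1)) _.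
    by rewrite lee_fin lambda_ge0.
  rewrite -EFinM lee_fin mulrA ler_wpM2r//.
  rewrite -{1}(powRr1 (lambda_ge0 q)).
  rewrite -powRD; last by rewrite (gt_eqF (lambda_gt0 q)) implybT.
  by rewrite (_ : 1 + (1 - 2 / r) = 2 - 2 / r)//; ring.
rewrite lee_fin.
have s0 : 0 <= 2 - 2 / r by rewrite subr_ge0 ler_pdivrMr// ler_peMr.
(* For q <= 0 the wavenumber gives no information, but the factor is at most 1 since 2 - 2/r >= 0,
   and a <= 1 + a^r. This case accounts for the summand 1 in front and for the 1 inside the
   coefficient. *)
have [q0|q0] := leP q 0.
  have lq1 : lambda q `^ (2 - 2 / r) <= 1.
    rewrite -[leRHS](powRr0 2) powR_lambda ler_powR ?ler1n//.
    by rewrite mulr_le0_ge0// lerz0.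
  apply: (@le_trans _ _ a); first by rewrite ler_piMl.
  have [a1|a1] := leP a 1.
    by apply: (le_trans a1); rewrite lerDl mulr_ge0 ?powR_ge0// ltW.
  apply: (@le_trans _ _ (a `^ r)).
    by rewrite -{1}[a]powRr1// ler_powR// ltW.
  apply: (@le_trans _ _ ((1 + k `^ (1 - r)) * a `^ r)).
    by rewrite ler_peMl ?powR_ge0// lerDl powR_ge0.
  by rewrite lerDr.
(* Otherwise q - 1, which is nonnegative because q >= 1, would be admissible in the definition of
   Lambda, giving Lambda <= 2^(q-1) and contradicting 2^q <= Lambda. *)
have [p qp kp] : exists2 p, q <= p &
    (k%:E <= (lambda p)^-1%:E * block_norm chi p +oo v)%E.
  apply: contrapT => np.
  have : (wavenumber chi c0 nu v <= (lambda (q - 1))%:E)%E.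
    apply: ereal_inf_lbound; exists (q - 1) => //; split; first by lia.
    move=> p pq; rewrite ltNge; apply/negP => kp; apply: np; exists p => //; lia.
  rewrite le_wave_index in qw.
  by move=> /(le_trans qw); rewrite lee_fin ler_lambda; lia.
(* The powers of [lambda p] combine to the exponent -1 + (1 - 2/r) = -2/r <= 0, so p may be replaced
   by the smaller q. *)
have ka : k <= lambda q `^ (- (2 / r)) * a.
  rewrite -lee_fin; apply: (le_trans kp).
  have p1 : -1 <= p by lia.
  apply: le_trans (lee_wpmul2l _ (block_le p p1)) _.
    by rewrite lee_fin invr_ge0 lambda_ge0.
  rewrite -EFinM lee_fin mulrA ler_wpM2r//.
  rewrite -powR_inv1 ?lambda_ge0// -powRD; last first.
    by rewrite (gt_eqF (lambda_gt0 p)) implybT.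
  rewrite addrA addNr add0r !powR_lambda ler_powR ?ler1n//.
  by rewrite ler_wnM2r ?ler_int// oppr_le0 divr_ge0// ltW.
have la : lambda q `^ (2 / r) <= k^-1 * a.
  rewrite ler_pdivlMl//.
  by rewrite mulrC -ler_pdivlMl ?powR_gt0 ?lambda_gt0// -powRN.
have : lambda q `^ (2 - 2 / r) <= k `^ (1 - r) * a `^ (r - 1).
  have -> : 2 - 2 / r = 2 / r * (r - 1) by field; rewrite gt_eqF.
  have -> : k `^ (1 - r) = k^-1 `^ (r - 1).
    by rewrite -powR_inv1 ?(ltW k0)// -powRrM mulN1r opprB.
  have kV0 : 0 <= k^-1 by rewrite invr_ge0 ltW.
  by rewrite powRrM -powRM// ge0_ler_powR ?subr_ge0// nnegrE ?powR_ge0 ?mulr_ge0.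
move=> /(ler_wpM2r a0) /le_trans; apply.
(* The exponents r - 1 and 1 add up to r, which is nonzero, so the power law holds even for a =
   0. *)
rewrite -mulrA -{2}(powRr1 a0) -powRD subrK; last by rewrite (gt_eqF r0).
by rewrite mulrDl mul1r addrA lerDr addr_ge0// powR_ge0.
Qed.

End low_modes.

(** * Smooth compactly supported functions *)

(* A directional derivative only depends on the restriction to a line. *)
Lemma is_derive_line (R : realType) (V W : normedModType R) (f : V -> R) (g : W -> R)
    (x v : V) (y w : W) (d : R) :
  (forall h : R, f (h *: v + x) = g (h *: w + y)) ->
  is_derive x v f d -> is_derive y w g d.
Proof.
move=> fg [df <-].
have E : (fun h : R => h^-1 *: ((f \o shift x) (h *: v) - f x)) =
         (fun h : R => h^-1 *: ((g \o shift y) (h *: w) - g y)).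
  apply/funext => h /=; rewrite fg.
  by have := fg 0; rewrite !scale0r !add0r => ->.
by split; rewrite /derivable /derive -E.
Qed.

(** The sigma-algebra here is the product one, generated by rectangles. An open set is the countable
    union of the cubes with rational centre and radius 1/(n+1) that it contains. *)
Lemma continuous_measurable3 (R : realType) (g : space3 R -> R) :
  continuous g -> measurable_fun [set: mspace3 R] g.
Proof.
move=> cg; apply: (measurability _ (RGenOpens.measurableE R)) => //.
move=> _ [_ [a [b ->] <-]]; rewrite setTI.
have : open (g @^-1` `]a, b[%classic) by move/continuousP : cg; exact.
move: (g @^-1` _) => U oU.
pose S (i : rat * rat * rat * nat) : set (mspace3 R) :=
  (ball (ratr i.1.1.1 : R) i.2.+1%:R^-1 `*` ball (ratr i.1.1.2 : R) i.2.+1%:R^-1)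
    `*` ball (ratr i.1.2 : R) i.2.+1%:R^-1.
rewrite [X in measurable X](_ : _ = \bigcup_i (if `[< S i `<=` U >] then S i else set0)).
  apply: countable_bigcupT_measurable => // i; case: ifPn => // _.
  apply: measurableX; last exact: measurable_ball.
  by apply: measurableX; exact: measurable_ball.
apply/seteqP; split => [x Ux|x [i _]]; last by case: ifPn => // /asboolP; exact.
have /nbhs_ballP[e /= e0 xeU] : nbhs x U by exact: open_nbhs_nbhs.
(* Two points of a cube of radius less than e/2 are within e of each other, so a cube containing x
   lies in the ball of radius e around x. *)
have [n ne] : exists n : nat, n.+1%:R^-1 < e / 2.
  have := near_infty_natSinv_lt (PosNum (divr_gt0 e0 (ltr0n R 2))).
  by move=> [n _ /(_ n (leqnn n)) /= ?]; exists n.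
have rat_near (y : R) : exists q : rat, ball (ratr q : R) n.+1%:R^-1 y.
  have [] := @dense_rat R (ball y n.+1%:R^-1) _ _.
  - by exists y; exact: ballxx.
  - exact: ball_open.
  - by move=> z [yz [q _ qz]]; exists q; rewrite qz; exact: ball_sym.
have [q1 xq1] := rat_near x.1.1.
have [q2 xq2] := rat_near x.1.2.
have [q3 xq3] := rat_near x.2.
exists (q1, q2, q3, n) => //.
case: asboolP => [_|]; first by [].
case=> y [[yq1 yq2] yq3]; apply: xeU.
have tri (q : rat) (s t : R) : ball (ratr q : R) n.+1%:R^-1 s ->
    ball (ratr q : R) n.+1%:R^-1 t -> ball s e t.
  move=> /ball_sym qs qt; apply: le_ball (ball_triangle qs qt).
  by rewrite [e]splitr lerD// ltW.
by split; [split|]; apply: tri; eassumption.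
Qed.

Section Ck_closure.
Context {R : realType} {V : normedModType R}.
Implicit Types f g : V -> R.

Lemma Ck_continuous k f : Ck k f -> continuous f.
Proof. by case: k => [[]|k []]. Qed.

(** By the chain rule the derivative of x |-> f(c x) along v is the derivative of f along c v, taken
    at c x. Absorbing c into the direction leaves a function of the same form, so the induction
    closes. *)
Lemma Ck_scale k f (c : R) : Ck k f -> Ck k (fun x => f (c *: x)).
Proof.
elim: k f => [|k IH] f [cf Df]; split=> //.
- by move=> x; apply: (continuous_comp _ (cf _)); exact: scaler_continuous.
- by move=> x; apply: (continuous_comp _ (cf _)); exact: scaler_continuous.
move=> v; have [dfc Cfc] := Df (c *: v).
have dv x : is_derive x v (fun x => f (c *: x)) ('D_(c *: v) f (c *: x)).
  apply: (@is_derive_line _ _ _ f _ (c *: x) (c *: v)) (derivableP (dfc _)).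
  by move=> h; rewrite scalerDr !scalerA mulrC.
split=> [x|]; first exact: ex_derive.
rewrite (_ : (fun x => _) = (fun x => 'D_(c *: v) f (c *: x))).
  exact: (IH (fun x => 'D_(c *: v) f x)).
by apply/funext => x; rewrite derive_val.
Qed.

Lemma Ck_sub k f g : Ck k f -> Ck k g -> Ck k (fun x => f x - g x).
Proof.
elim: k f g => [|k IH] f g [cf Df] [cg Dg]; split=> //.
- by move=> x; apply: cvgB; [exact: cf|exact: cg].
- by move=> x; apply: cvgB; [exact: cf|exact: cg].
move=> v; have [dfv Cfv] := Df v; have [dgv Cgv] := Dg v.
split=> [x|]; first exact: derivableB.
rewrite (_ : (fun x => _) = (fun x => 'D_v f x - 'D_v g x)).
  exact: (IH (fun x => 'D_v f x) (fun x => 'D_v g x)).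
by apply/funext => x; rewrite -deriveB.
Qed.

(** Vanishing outside a ball stands in for compact support, and passes directly to derivatives,
    scalings and differences. The finite order k keeps count of the derivatives still available. *)
Definition Ck_bounded_supp k f :=
  Ck k f /\ exists M : R, forall x, M < `|x| -> f x = 0.

Lemma CkS k f : Ck k.+1 f -> Ck k f.
Proof.
elim: k f => [|k IH] f [cf Df]; split=> // v.
by have [dfv Cfv] := Df v; split=> //; exact: IH.
Qed.

Lemma Ck_bounded_suppS k f : Ck_bounded_supp k.+1 f -> Ck_bounded_supp k f.
Proof. by move=> [/CkS]. Qed.

Lemma Ck_bounded_supp1 k f : Ck_bounded_supp k.+1 f -> Ck_bounded_supp 1 f.
Proof. by elim: k => // k IH /Ck_bounded_suppS. Qed.

(** The region M < |x| is open, so f vanishes near each of its points and the same M serves for the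
    derivative. *)
Lemma Ck_bounded_supp_derive k f v : Ck_bounded_supp k.+1 f ->
  Ck_bounded_supp k (fun x => 'D_v f x).
Proof.
move=> [[cf Df] [M Mf]]; split; first by have [] := Df v.
exists M => x Mx; rewrite -(derive_cst 0 x v); apply: near_eq_derive.
have oM : open [set y : V | M < `|y|].
  by apply: open_comp (@open_gt R M) => y _; exact: norm_continuous.
by apply: filterS (open_nbhs_nbhs (conj oM Mx)) => y /Mf.
Qed.

End Ck_closure.

(** * Integrals of compactly supported functions *)

Lemma integrable_bounded_on d (X : measurableType d) (R : realType)
    (mu : {measure set X -> \bar R}) (A : set X) (f : X -> R) (B : R) :
  measurable A -> (mu A < +oo)%E -> measurable_fun setT f ->
  (forall x, `|f x| <= B) -> (forall x, ~ A x -> f x = 0) ->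
  mu.-integrable setT (EFin \o f).
Proof.
move=> mA Afin mf fB f0.
rewrite (_ : f = f \_ A).
  rewrite -restrict_EFin; apply/integrable_restrict => //; rewrite setTI.
  apply: measurable_bounded_integrable => //; first exact: measurable_funS mf.
  exists B; split=> [|M BM x _]; first exact: num_real.
  exact: le_trans (fB x) (ltW BM).
apply/funext => x; rewrite patchE; case: ifPn => // /negP xA.
by apply: f0 => Ax; apply: xA; rewrite inE.
Qed.

Lemma product_measure1_lty d1 d2 (T1 : measurableType d1) (T2 : measurableType d2)
    (R : realType) (m1 : {measure set T1 -> \bar R})
    (m2 : {sigma_finite_measure set T2 -> \bar R}) (A1 : set T1) (A2 : set T2) :
  measurable A1 -> measurable A2 -> (m1 A1 < +oo)%E -> (m2 A2 < +oo)%E ->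
  ((m1 \x m2) (A1 `*` A2) < +oo)%E.
Proof.
move=> mA1 mA2 A1fin A2fin; rewrite product_measure1E//.
by rewrite lte_mul_pinfty// ge0_fin_numE.
Qed.

Lemma lebesgue_itv_fin (R : realType) (a b : R) :
  (@lebesgue_measure R `[a, b]%classic < +oo)%E.
Proof. by rewrite lebesgue_measure_itv/=; case: ifP => //; rewrite ltry. Qed.

(* The library's sigma-finite structure on a product measure is shadowed by the
   one for products of finite measures, so it is declared on the aliases [leb2]
   and [leb3s]; the latter is convertible to [leb3]. *)
Definition leb2 {R : realType} :
    set (measurableTypeR R * measurableTypeR R) -> \bar R :=
  (@lebesgue_measure R \x @lebesgue_measure R)%E.

HB.instance Definition _ (R : realType) := Measure.on (@leb2 R).

Lemma leb2_sigma_finite (R : realType) : sigma_finite setT (@leb2 R).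
Proof.
pose F (n : nat) : set (measurableTypeR R) := `[- n%:R, n%:R]%classic.
have mF n : measurable (F n) by exact: measurable_itv.
exists (fun n => F n `*` F n).
  rewrite predeqE => -[x y]; split => // _.
  exists (Num.truncn (`|x| + `|y|)).+1 => //; rewrite /F /= !in_itv/= -!ler_norml.
  have /ltW xy := truncnS_gt (`|x| + `|y|).
  by split; apply: le_trans xy; rewrite ?lerDl ?lerDr.
move=> n; split; first exact: measurableX.
by apply: (product_measure1_lty (mF n) (mF n)); exact: lebesgue_itv_fin.
Qed.

HB.instance Definition _ (R : realType) :=
  Measure_isSigmaFinite.Build _ _ _ (@leb2 R) (@leb2_sigma_finite R).

Section iterated_integral_eq0.
Local Open Scope ereal_scope.
Context d1 d2 (T1 : measurableType d1) (T2 : measurableType d2) (R : realType).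
Variables (m1 : {sigma_finite_measure set T1 -> \bar R})
          (m2 : {sigma_finite_measure set T2 -> \bar R}) (f : T1 * T2 -> \bar R).
Hypothesis fi : (m1 \x m2).-integrable setT f.

Lemma integral_prod_eq0l :
  (forall y, \int[m1]_x f (x, y) = 0) -> \int[m1 \x m2]_z f z = 0.
Proof.
by move=> f0; rewrite -integral21_prod_meas1//; apply: integral0_eq => y _; exact: f0.
Qed.

Lemma integral_prod_eq0r :
  (forall x, \int[m2]_y f (x, y) = 0) -> \int[m1 \x m2]_z f z = 0.
Proof.
by move=> f0; rewrite -integral12_prod_meas1//; apply: integral0_eq => y _; exact: f0.
Qed.

End iterated_integral_eq0.

Lemma integral_derive_eq0 (R : realType) (p dp : R -> R) (M : R) :
  continuous dp -> (forall x : R, is_derive x (1 : R) p (dp x)) ->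
  (forall x, M < `|x| -> p x = 0) -> (forall x, M < `|x| -> dp x = 0) ->
  (\int[lebesgue_measure]_x (dp x)%:E = 0)%E.
Proof.
move=> cdp dpE p0 dp0.
(* M may be negative; N is positive and exceeds M, so the interval is nondegenerate and p vanishes
   at both endpoints. *)
pose N : R := `|M| + 1.
have MN : M < N by rewrite /N (le_lt_trans (ler_norm M))// ltrDl.
have N0 : 0 < N by rewrite /N ltr_wpDl.
have cp x : {for x, continuous p}.
  by apply/differentiable_continuous/derivable1_diffP; have [] := dpE x.
transitivity (\int[lebesgue_measure]_(x in `[(- N)%R, N]) (dp x)%:E)%E.
  rewrite [RHS]integral_mkcond; apply: eq_integral => x _.
  rewrite patchE; case: ifPn => //; rewrite notin_setE /= in_itv/= => /negP xN.
  by rewrite dp0// (lt_le_trans MN)// leNgt; apply: contra xN => /ltW; rewrite ler_norml.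
rewrite (@continuous_FTC2 _ dp p)//.
- by rewrite !p0 ?sube0// ?normrN gtr0_norm.
- by rewrite (@lt_trans _ _ 0) ?oppr_lt0.
- exact: continuous_subspaceT.
- split; first by move=> x _; have [] := dpE x.
  + by apply: cvg_at_right_filter; exact: cp.
  + by apply: cvg_at_left_filter; exact: cp.
- by move=> x _; rewrite derive1E; have [_ ->] := dpE x.
Qed.

Section compactly_supported_integrals.
Context {R : realType}.
Implicit Types f : space3 R -> R.
Local Notation mu := (@lebesgue_measure R).

Definition box (M : R) : set (mspace3 R) := (`[- M, M] `*` `[- M, M]) `*` `[- M, M].

Lemma notin_box (M : R) (x : space3 R) : ~ box M x -> M < `|x|.
Proof.
move=> xM; rewrite ltNge; apply/negP; rewrite !prod_normE !ge_max !ler_norml.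
by move=> /andP[/andP[x1 x2] x3]; apply: xM; split; [split|]; rewrite /= in_itv.
Qed.

Lemma compact_supp_bounded f (M : R) : continuous f ->
  (forall x, M < `|x| -> f x = 0) -> exists B, forall x, `|f x| <= B.
Proof.
move=> cf f0.
have cbox : compact (box M : set (space3 R)).
  by apply: compact_setX; [apply: compact_setX|]; exact: segment_compact.
have /compact_bounded[B [_ Bf]] : compact (f @` (box M : set (space3 R))).
  by apply: continuous_compact => //; exact: continuous_subspaceT.
exists (`|B| + 1) => x.
have [xM|/notin_box/f0 ->] := pselect (box M x).
  by apply: (Bf (`|B| + 1)); [rewrite (le_lt_trans (ler_norm B))// ltrDl|exists x].
by rewrite normr0 addr_ge0.
Qed.

Lemma leb3_box_fin (M : R) : (leb3 (box M) < +oo)%E.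
Proof.
have mI : @measurable _ (measurableTypeR R) `[- M, M] by exact: measurable_itv.
apply: (product_measure1_lty (measurableX mI mI) mI).
  by apply: (product_measure1_lty mI mI); exact: lebesgue_itv_fin.
exact: lebesgue_itv_fin.
Qed.

Lemma compact_supp_integrable f (M : R) : continuous f ->
  (forall x, M < `|x| -> f x = 0) -> leb3.-integrable setT (EFin \o f).
Proof.
move=> cf f0; have [B fB] := compact_supp_bounded cf f0.
apply: (@integrable_bounded_on _ _ _ _ (box M) _ B) => //.
- by apply: measurableX => //; exact: measurableX.
- exact: leb3_box_fin.
- exact: continuous_measurable3.
- by move=> x /notin_box/f0.
Qed.

(** By Fubini the j-th coordinate is integrated first, and the fundamental theorem of calculus gives
    0. As [leb3] is nested as ((x1, x2), x3), the first two coordinates take a second use of Fubini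
    on the slices at fixed x3. *)
Lemma integral_partial_eq0 (j : 'I_3) (psi dpsi : space3 R -> R) (M : R) :
  continuous dpsi -> (forall x, is_derive x (unit_vec j) psi (dpsi x)) ->
  (forall x, M < `|x| -> psi x = 0) -> (forall x, M < `|x| -> dpsi x = 0) ->
  (\int[leb3]_x (dpsi x)%:E = 0)%E.
Proof.
move=> cd dE p0 d0.
have idpsi : leb3.-integrable setT (EFin \o dpsi) by exact: (compact_supp_integrable cd d0).
have [B dB] := compact_supp_bounded cd d0.
have slice c : leb2.-integrable setT (EFin \o (fun ab => dpsi (ab, c))).
  have mI : @measurable _ (measurableTypeR R) `[- M, M] by exact: measurable_itv.
  apply: (integrable_bounded_on (measurableX mI mI) _ _ (fun ab => dB (ab, c))).
  - by apply: (product_measure1_lty mI mI); exact: lebesgue_itv_fin.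
  - apply: (@measurable_fun_pair1 _ _ _ _ _ _ dpsi c).
    exact: continuous_measurable3.
  - by move=> ab abM; apply/d0/notin_box => -[].
case: j dE => -[|[|[|//]]] /= ? dE.
- apply: (@integral_prod_eq0l _ _ _ _ R leb2 mu _ idpsi) => c.
  apply: (@integral_prod_eq0l _ _ _ _ R mu mu _ (slice c)) => b.
  have aM (a : R) : `|a| <= `|((a, b), c)|.
    by rewrite !prod_normE/= !le_max lexx.
  apply: (@integral_derive_eq0 _ (fun a => psi ((a, b), c))
    (fun a => dpsi ((a, b), c)) M) => [a|a|a Ma|a Ma].
  + apply: (@continuous_comp _ _ _ (fun a : R => ((a, b), c) : space3 R) dpsi);
      last exact: cd.
    exact: (cvg_pair (cvg_pair cvg_id (cvg_cst b)) (cvg_cst c)).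
  + apply: is_derive_line (dE ((a, b), c)) => h; congr psi.
    by congr ((_, _), _) => /=; rewrite /GRing.scale/= ?mulr0 ?add0r.
  + exact/p0/(lt_le_trans Ma).
  + exact/d0/(lt_le_trans Ma).
- apply: (@integral_prod_eq0l _ _ _ _ R leb2 mu _ idpsi) => c.
  apply: (@integral_prod_eq0r _ _ _ _ R mu mu _ (slice c)) => a.
  have bM (b : R) : `|b| <= `|((a, b), c)|.
    by rewrite !prod_normE/= !le_max lexx ?orbT.
  apply: (@integral_derive_eq0 _ (fun b => psi ((a, b), c))
    (fun b => dpsi ((a, b), c)) M) => [b|b|b Mb|b Mb].
  + apply: (@continuous_comp _ _ _ (fun b : R => ((a, b), c) : space3 R) dpsi);
      last exact: cd.
    exact: (cvg_pair (cvg_pair (cvg_cst a) cvg_id) (cvg_cst c)).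
  + apply: is_derive_line (dE ((a, b), c)) => h; congr psi.
    by congr ((_, _), _) => /=; rewrite /GRing.scale/= ?mulr0 ?add0r.
  + exact/p0/(lt_le_trans Mb).
  + exact/d0/(lt_le_trans Mb).
- apply: (@integral_prod_eq0r _ _ _ _ R leb2 mu _ idpsi) => -[a b].
  have cM (c : R) : `|c| <= `|((a, b), c)|.
    by rewrite !prod_normE/= !le_max lexx ?orbT.
  apply: (@integral_derive_eq0 _ (fun c => psi ((a, b), c))
    (fun c => dpsi ((a, b), c)) M) => [c|c|c Mc|c Mc].
  + apply: (@continuous_comp _ _ _ (fun c : R => ((a, b), c) : space3 R) dpsi);
      last exact: cd.
    exact: (cvg_pair (cvg_cst (a, b)) cvg_id).
  + apply: is_derive_line (dE ((a, b), c)) => h; congr psi.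
    by congr ((_, _), _) => /=; rewrite /GRing.scale/= ?mulr0 ?add0r.
  + exact/p0/(lt_le_trans Mc).
  + exact/d0/(lt_le_trans Mc).
Qed.

End compactly_supported_integrals.

(** * Decay of Fourier integrals *)

Section trigonometric_integrals.
Context {R : realType}.
Implicit Types (g : space3 R -> R) (x : space3 R).

Definition cos_int g x : R := \int[leb3]_xi (g xi * cos (dot xi x)).
Definition sin_int g x : R := \int[leb3]_xi (g xi * sin (dot xi x)).
(** The squared modulus of the integral of g(xi) e^(i xi.x), kept in real form. *)
Definition fourier_sqr g x : R := cos_int g x ^+ 2 + sin_int g x ^+ 2.

Definition coord (j : 'I_3) x : R := dot (unit_vec j) x.

Lemma dotDl (h : R) (v w x : space3 R) : dot (h *: v + w) x = h * dot v x + dot w x.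
Proof. rewrite /dot /= /GRing.scale/= /GRing.scale/=; ring. Qed.

Lemma continuous_dot x : continuous (fun xi : space3 R => dot xi x).
Proof.
move=> xi; rewrite /dot; apply: cvgD; first apply: cvgD.
- apply: cvgM; last exact: cvg_cst.
  exact: (cvg_comp _ _ (@cvg_fst _ _ (nbhs xi.1) (nbhs xi.2) _)
    (@cvg_fst _ _ (nbhs xi.1.1) (nbhs xi.1.2) _)).
- apply: cvgM; last exact: cvg_cst.
  exact: (cvg_comp _ _ (@cvg_fst _ _ (nbhs xi.1) (nbhs xi.2) _)
    (@cvg_snd _ _ (nbhs xi.1.1) (nbhs xi.1.2) _)).
- apply: cvgM; last exact: cvg_cst.
  exact: (@cvg_snd _ _ (nbhs xi.1) (nbhs xi.2) _).
Qed.

Lemma is_derive_comp_dot (j : 'I_3) (xi x : space3 R) (f : R -> R) (df : R) :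
  is_derive (dot xi x) (1 : R) f df ->
  is_derive xi (unit_vec j) (fun xi : space3 R => f (dot xi x)) (df * coord j x).
Proof.
(* On the line through xi in the direction of the j-th unit vector, the dot product with x is affine
   with slope x_j. *)
move=> fd; pose a (s : R) : R := s * coord j x + dot xi x.
have ad : is_derive (0 : R) (1 : R) a (coord j x).
  have := is_deriveD (is_deriveM (is_derive_id (0 : R) (1 : R))
    (is_derive_cst (coord j x) (0 : R) (1 : R))) (is_derive_cst (dot xi x) (0 : R) (1 : R)).
  by rewrite scaler0 add0r addr0 /GRing.scale/= mulr1.
have a0 : a 0 = dot xi x by rewrite /a mul0r add0r.
rewrite -a0 in fd; have fad := is_derive1_comp fd ad.
apply: (is_derive_line _ fad) => h.
by rewrite /a /= dotDl /GRing.scale/= mulr1 addr0.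
Qed.

Lemma continuous_comp_dot x (f : R -> R) :
  continuous f -> continuous (fun xi : space3 R => f (dot xi x)).
Proof.
move=> cf xi; apply: (@continuous_comp _ _ _ (fun xi : space3 R => dot xi x) f).
  exact: continuous_dot.
exact: cf.
Qed.

Lemma integrable_mul_dot k g x (f : R -> R) :
  Ck_bounded_supp k g -> continuous f ->
  leb3.-integrable setT (EFin \o (fun xi => g xi * f (dot xi x))).
Proof.
move=> [/Ck_continuous cg [M g0]] cf.
apply: (@compact_supp_integrable _ _ M) => [xi|xi /g0 ->]; last by rewrite mul0r.
by apply: cvgM; [exact: cg|exact: continuous_comp_dot].
Qed.

(** The integrand of the left side plus that of the right is the j-th partial derivative of g(xi)
    f(xi.x), which has bounded support and hence integral 0. *)
Lemma integral_parts (j : 'I_3) g x (f df : R -> R) :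
  Ck_bounded_supp 1 g -> continuous f -> continuous df ->
  (forall s : R, is_derive s (1 : R) f (df s)) ->
  \int[leb3]_xi (partial j g xi * f (dot xi x)) =
  - (coord j x * \int[leb3]_xi (g xi * df (dot xi x))).
Proof.
move=> bg cf cdf fdf.
have bdg : Ck_bounded_supp 0 (partial j g) := Ck_bounded_supp_derive (unit_vec j) bg.
have i1 := integrable_mul_dot x bdg cf.
have i2 := integrable_mul_dot x bg cdf.
have [[cdg _] [M' dg0]] := bdg; have [[cg Dg] [M g0]] := bg.
have [dg _] := Dg (unit_vec j).
have cfd : continuous (fun xi : space3 R => f (dot xi x)) by exact: continuous_comp_dot.
have cdfd : continuous (fun xi : space3 R => df (dot xi x)) by exact: continuous_comp_dot.
pose N := Num.max M M'.
have gN xi : N < `|xi| -> g xi = 0.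
  by move=> Nxi; apply: g0; apply: le_lt_trans Nxi; rewrite le_max lexx.
have dgN xi : N < `|xi| -> partial j g xi = 0.
  by move=> Nxi; apply: dg0; apply: le_lt_trans Nxi; rewrite le_max lexx orbT.
have i3 : leb3.-integrable setT (EFin \o (fun xi => coord j x * (g xi * df (dot xi x)))).
  apply: (@compact_supp_integrable _ _ N) => [xi|xi /gN ->]; last by rewrite mul0r mulr0.
  by apply: cvgM; [exact: cvg_cst|apply: cvgM; [exact: cg|exact: cdfd]].
have : \int[leb3]_xi (partial j g xi * f (dot xi x) + coord j x * (g xi * df (dot xi x))) = 0.
  apply: (congr1 fine (_ : _ = 0%E)).
  apply: (@integral_partial_eq0 _ j (fun xi => g xi * f (dot xi x))
    (fun xi => partial j g xi * f (dot xi x) + coord j x * (g xi * df (dot xi x))) N).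
  - move=> xi; apply: cvgD; first by apply: cvgM; [exact: cdg|exact: cfd].
    by apply: cvgM; [exact: cvg_cst|apply: cvgM; [exact: cg|exact: cdfd]].
  - move=> xi.
    have := is_deriveM (derivableP (dg xi)) (is_derive_comp_dot j (fdf (dot xi x))).
    congr (is_derive _ _ _ _); rewrite /GRing.scale/= /partial; ring.
  - by move=> xi /gN ->; rewrite mul0r.
  - by move=> xi Nxi; rewrite gN// dgN// !mul0r mulr0 addr0.
rewrite RintegralD// RintegralZl//.
by move/eqP; rewrite addr_eq0 => /eqP.
Qed.

(** Differentiating g in xi_j multiplies its Fourier integral by -i x_j: the cosine and sine
    integrals are exchanged, up to sign, with a factor x_j. *)
Lemma coord_sqr_fourier (j : 'I_3) g x : Ck_bounded_supp 1 g ->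
  coord j x ^+ 2 * fourier_sqr g x = fourier_sqr (partial j g) x.
Proof.
move=> bg; rewrite /fourier_sqr /cos_int /sin_int.
have csin : continuous (fun s : R => - sin s) by move=> s; apply: cvgN; exact: continuous_sin.
rewrite (integral_parts j x bg (@continuous_cos R) csin (@is_derive_cos R)).
rewrite (integral_parts j x bg (@continuous_sin R) (@continuous_cos R) (@is_derive_sin R)).
have -> : \int[leb3]_xi (g xi * - sin (dot xi x)) = - \int[leb3]_xi (g xi * sin (dot xi x)).
  rewrite -mulN1r -RintegralZl//; last exact: integrable_mul_dot bg (@continuous_sin R).
  by apply: eq_Rintegral => xi _; rewrite mulrN mulN1r.
ring.
Qed.

Lemma sqr_integral_mul_dot_le k g x (f : R -> R) : Ck_bounded_supp k g ->
  continuous f -> (forall s, `|f s| <= 1) ->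
  (\int[leb3]_xi (g xi * f (dot xi x))) ^+ 2 <= (\int[leb3]_xi `|g xi|) ^+ 2.
Proof.
move=> bg cf f1; have ig := integrable_mul_dot x bg cf.
rewrite -real_normK ?num_real// lerXn2r ?nnegrE//.
  by apply: Rintegral_ge0.
apply: le_trans (le_normr_Rintegral _ ig) _ => //.
apply: le_Rintegral => //; first exact: integrable_norm.
  have [/Ck_continuous cg [M g0]] := bg.
  exact: (integrable_norm (compact_supp_integrable cg g0)).
by move=> xi _; rewrite normrM ler_piMr.
Qed.

Lemma fourier_sqr_bounded k g : Ck_bounded_supp k g ->
  exists K, forall x, fourier_sqr g x <= K.
Proof.
move=> bg; exists ((\int[leb3]_xi `|g xi|) ^+ 2 *+ 2) => x.
rewrite mulr2n lerD// (sqr_integral_mul_dot_le _ bg)//.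
- exact: continuous_cos.
- exact: cos_max.
- exact: continuous_sin.
- exact: sin_max.
Qed.

(** One order of smoothness buys one factor 1 + x_j^2. The weight w is arbitrary so that the step
    can be iterated over the coordinates. *)
Lemma fourier_sqr_decay_step k (j : 'I_3) (w : space3 R -> R) :
  (forall g, Ck_bounded_supp k g ->
    exists K, forall x, w x * fourier_sqr g x <= K) ->
  forall g, Ck_bounded_supp k.+1 g ->
    exists K, forall x, (1 + coord j x ^+ 2) * w x * fourier_sqr g x <= K.
Proof.
move=> H g bg.
have [K1 gK1] := H g (Ck_bounded_suppS bg).
have [K2 gK2] := H _ (Ck_bounded_supp_derive (unit_vec j) bg).
exists (K1 + K2) => x; rewrite mulrDl mul1r mulrDl lerD// (mulrC (_ ^+ 2)) -mulrA.
rewrite coord_sqr_fourier//; exact: Ck_bounded_supp1 bg.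
Qed.

(** One derivative per coordinate, hence class C^3; the reciprocal of the resulting weight is
    integrable on R^3. *)
Lemma fourier_sqr_decay g : Ck_bounded_supp 3 g ->
  exists K, forall x : space3 R,
    (1 + x.1.1 ^+ 2) * ((1 + x.1.2 ^+ 2) * (1 + x.2 ^+ 2)) * fourier_sqr g x <= K.
Proof.
have coord0 x : coord 0 x = x.1.1 by rewrite /coord /dot /= !mul0r mul1r !addr0.
have coord1 x : coord 1 x = x.1.2 by rewrite /coord /dot /= !mul0r mul1r addr0 add0r.
have coord2 x : coord 2 x = x.2 by rewrite /coord /dot /= !mul0r mul1r !add0r.
move=> bg.
have H0 h : Ck_bounded_supp 0 h -> exists K, forall x, 1 * fourier_sqr h x <= K.
  move=> /fourier_sqr_bounded[K hK]; by exists K => x; rewrite mul1r.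
have := fourier_sqr_decay_step 0 (fourier_sqr_decay_step 1 (fourier_sqr_decay_step 2 H0)).
move=> /(_ g bg) [K gK]; exists K => x; have := gK x.
by rewrite coord0 coord1 coord2 mulr1.
Qed.

End trigonometric_integrals.

(** * Square integrability of the kernels *)

Section product_integrals.
Context d1 d2 (T1 : measurableType d1) (T2 : measurableType d2) (R : realType).
Variables (m1 : {sigma_finite_measure set T1 -> \bar R})
          (m2 : {sigma_finite_measure set T2 -> \bar R}).

(** Tonelli gives measurability for the positive and negative parts separately, and the integral is
    the finite part of their difference. *)
Lemma measurable_Rintegral_parameter (f : T1 * T2 -> R) :
  measurable_fun setT f ->
  measurable_fun setT (fun x => \int[m2]_y f (x, y)).
Proof.
move=> mf; have mef : measurable_fun setT (EFin \o f) by exact/measurable_EFinP.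
apply: (measurableT_comp (@fine_measurable R setT measurableT)).
rewrite (_ : (fun x => _) = (fun x => fubini_F m2 ((EFin \o f)^\+)%E x
    - fubini_F m2 ((EFin \o f)^\-)%E x)%E); last first.
  apply/funext => x; rewrite integralE /fubini_F.
  congr (_ - _)%E; apply: eq_integral => y _; first by rewrite !funeposE.
  by rewrite !funenegE.
apply: emeasurable_funB; apply: measurable_fun_fubini_tonelli_F => //.
- exact: measurable_funepos.
- exact: measurable_funeneg.
Qed.

Lemma integral_prod_lty (f1 : T1 -> R) (f2 : T2 -> R) :
  measurable_fun setT f1 -> measurable_fun setT f2 ->
  (forall x, 0 <= f1 x) -> (forall y, 0 <= f2 y) ->
  (\int[m1]_x (f1 x)%:E < +oo)%E -> (\int[m2]_y (f2 y)%:E < +oo)%E ->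
  (\int[m1 \x m2]_z (f1 z.1 * f2 z.2)%:E < +oo)%E.
Proof.
move=> mf1 mf2 f10 f20 f1oo f2oo.
rewrite fubini_tonelli1/=; last 2 first.
- apply/measurable_EFinP/measurable_funM.
  + exact: (measurableT_comp mf1 measurable_fst).
  + exact: (measurableT_comp mf2 measurable_snd).
- by move=> z; rewrite lee_fin mulr_ge0.
rewrite /fubini_F/=.
have E x : (\int[m2]_y (f1 x * f2 y)%:E = (f1 x)%:E * \int[m2]_y (f2 y)%:E)%E.
  under eq_integral => y _ do rewrite EFinM.
  rewrite ge0_integralZl//; first exact/measurable_EFinP.
  - by move=> y _; rewrite lee_fin.
  - by rewrite lee_fin.
under eq_integral => x _ do rewrite E.
rewrite ge0_integralZr//.
- rewrite lte_mul_pinfty// ?integral_ge0// => [x _|]; first by rewrite lee_fin.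
  by rewrite ge0_fin_numE// integral_ge0// => x _; rewrite lee_fin.
- exact/measurable_EFinP.
- by move=> x _; rewrite lee_fin.
- by rewrite integral_ge0// => y _; rewrite lee_fin.
Qed.

End product_integrals.

Definition leb3s {R : realType} : set (mspace3 R) -> \bar R :=
  (@leb2 R \x @lebesgue_measure R)%E.

HB.instance Definition _ (R : realType) := Measure.on (@leb3s R).

Lemma leb3s_sigma_finite (R : realType) : sigma_finite setT (@leb3s R).
Proof.
exists (fun n : nat => box n%:R).
  rewrite predeqE => x; split => // _.
  exists (Num.truncn `|x|).+1 => //; apply: contrapT => /notin_box.
  by rewrite ltNge (ltW (truncnS_gt _)).
move=> n; split; last exact: leb3_box_fin.
by apply: measurableX; [apply: measurableX|].
Qed.

HB.instance Definition _ (R : realType) :=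
  Measure_isSigmaFinite.Build _ _ _ (@leb3s R) (@leb3s_sigma_finite R).

Section kernel_L2.
Context {R : realType}.
Local Notation mu := (@lebesgue_measure R).

Lemma measurable_integral_mul_dot (g : space3 R -> R) (f : R -> R) (x : space3 R) :
  continuous g -> continuous f ->
  measurable_fun [set: mspace3 R]
    (fun y : mspace3 R => \int[leb3]_xi (g xi * f (dot xi (x - y)))).
Proof.
move=> cg cf.
apply: (@measurable_Rintegral_parameter _ _ (mspace3 R) (mspace3 R) R leb3s
  (fun z => g z.2 * f (dot z.2 (x - z.1)))).
apply: measurable_funM.
  exact: (measurableT_comp (continuous_measurable3 cg) measurable_snd).
apply: (measurableT_comp (continuous_measurable_fun cf)).
rewrite /dot /=.
have mcoord (p : mspace3 R * mspace3 R -> mspace3 R) : measurable_fun setT p ->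
   [/\ measurable_fun setT (fun z => (p z).1.1), measurable_fun setT (fun z => (p z).1.2)
     & measurable_fun setT (fun z => (p z).2)].
  move=> mp; have m1 := measurableT_comp measurable_fst mp; split.
  - exact: (measurableT_comp measurable_fst m1).
  - exact: (measurableT_comp measurable_snd m1).
  - exact: (measurableT_comp measurable_snd mp).
have [a1 a2 a3] := mcoord _ measurable_fst.
have [b1 b2 b3] := mcoord _ measurable_snd.
by apply: measurable_funD; first apply: measurable_funD; apply: measurable_funM => //;
  apply: measurable_funB.
Qed.

Lemma integral_oneDsqrV_lty : (\int[mu]_x ((oneDsqr x)^-1)%:E < +oo)%E.
Proof.
rewrite ge0_symfun_integralT//.
- rewrite (_ : [set x : R | 0 <= x] = `[0, +oo[%classic); last first.
    by apply/seteqP; split => x /=; rewrite in_itv/= andbT.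
  by rewrite integral0y_oneDsqr -EFinM ltry.
- exact: continuous_oneDsqrV.
- by move=> x /=; rewrite /oneDsqr sqrrN.
Qed.

(** The difference of the two sides is 1 plus squares. The inequality trades a weight at x - y for
    one at y, at a cost depending on x only. *)
Lemma oneDsqr_shift_le (a b : R) : 1 + b ^+ 2 <= 2 * (1 + a ^+ 2) * (1 + (a - b) ^+ 2).
Proof.
rewrite -subr_ge0.
have -> : 2 * (1 + a ^+ 2) * (1 + (a - b) ^+ 2) - (1 + b ^+ 2) =
  1 + 2 * (a * (a - b)) ^+ 2 + (a + (a - b)) ^+ 2 by ring.
by apply: addr_ge0; [apply: addr_ge0 => //; apply: mulr_ge0 => //|]; exact: sqr_ge0.
Qed.

Lemma sqr_integral_decay_lty (k : space3 R -> R) (x : space3 R) (K : R) :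
  measurable_fun [set: mspace3 R] (fun y => k (x - y)) ->
  (forall z, (1 + z.1.1 ^+ 2) * ((1 + z.1.2 ^+ 2) * (1 + z.2 ^+ 2)) * k z ^+ 2 <= K) ->
  (\int[leb3]_y (k (x - y)%R ^+ 2)%:E < +oo)%E.
Proof.
move=> mk kK.
have oneDsqrV_ge0 s : 0 <= (oneDsqr s)^-1 :> R.
  by rewrite invr_ge0 (le_trans ler01)// oneDsqr_ge1.
have moneV : measurable_fun setT (fun s : R => (oneDsqr s)^-1).
  by apply: continuous_measurable_fun; exact: continuous_oneDsqrV.
have P0 (s : R) : 0 <= 1 + s ^+ 2 by rewrite addr_ge0// sqr_ge0.
pose w2 (p : R * R) := (oneDsqr p.1)^-1 * (oneDsqr p.2)^-1.
pose w3 (y : space3 R) := w2 y.1 * (oneDsqr y.2)^-1.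
have mw2 : measurable_fun [set: measurableTypeR R * measurableTypeR R] w2.
  apply: measurable_funM.
    exact: (measurableT_comp moneV measurable_fst).
  exact: (measurableT_comp moneV measurable_snd).
have w2_ge0 p : 0 <= w2 p by rewrite mulr_ge0.
have w2oo : (\int[leb2]_p (w2 p)%:E < +oo)%E.
  exact: (@integral_prod_lty _ _ _ _ R mu mu _ _ moneV moneV oneDsqrV_ge0 oneDsqrV_ge0
    integral_oneDsqrV_lty integral_oneDsqrV_lty).
have w3oo : (\int[leb3s]_y (w3 y)%:E < +oo)%E.
  exact: (@integral_prod_lty _ _ _ _ R leb2 mu _ _ mw2 moneV w2_ge0 oneDsqrV_ge0 w2oo integral_oneDsqrV_lty).
have mw3 : measurable_fun [set: mspace3 R] w3.
  apply: measurable_funM.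
    exact: (measurableT_comp mw2 measurable_fst).
  exact: (measurableT_comp moneV measurable_snd).
(* The factor 8 = 2^3 collects the 2 of [oneDsqr_shift_le] from each of the three coordinates. *)
pose C := 8 * ((1 + x.1.1 ^+ 2) * ((1 + x.1.2 ^+ 2) * (1 + x.2 ^+ 2))) * K.
have X0 : 0 <= 8 * ((1 + x.1.1 ^+ 2) * ((1 + x.1.2 ^+ 2) * (1 + x.2 ^+ 2))).
  by rewrite !mulr_ge0.
have kC y : k (x - y) ^+ 2 <= C * w3 y.
  have D0 (s : R) : 0 < oneDsqr s by rewrite (lt_le_trans ltr01)// oneDsqr_ge1.
  rewrite /w3 /w2 -!invfM ler_pdivlMr ?mulr_gt0//.
  have S3 : oneDsqr y.1.1 * oneDsqr y.1.2 * oneDsqr y.2 <=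
    (2 * (1 + x.1.1 ^+ 2) * (1 + (x - y).1.1 ^+ 2)) *
    (2 * (1 + x.1.2 ^+ 2) * (1 + (x - y).1.2 ^+ 2)) *
    (2 * (1 + x.2 ^+ 2) * (1 + (x - y).2 ^+ 2)).
    by rewrite !ler_pM ?mulr_ge0 ?P0//; exact: oneDsqr_shift_le.
  rewrite mulrC; apply: le_trans (ler_wpM2r (sqr_ge0 _) S3) _.
  rewrite /C.
  by apply: le_trans (ler_wpM2l X0 (kK (x - y))); rewrite le_eqVlt; apply/orP; left;
    apply/eqP; ring.
apply: (@le_lt_trans _ _ (\int[leb3]_y (C * w3 y)%:E)%E).
  apply: ge0_le_integral => //.
  - by move=> y _; rewrite lee_fin sqr_ge0.
  - by apply/measurable_EFinP/measurable_funX.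
  - by apply/measurable_EFinP/measurable_funM => //; exact: measurable_cst.
  - by move=> y _; rewrite lee_fin kC.
have w3_ge0 y : 0 <= w3 y by rewrite mulr_ge0.
have K0 : 0 <= K.
  apply: le_trans (kK 0); apply: mulr_ge0 (sqr_ge0 _).
  by apply: mulr_ge0; [exact: P0|apply: mulr_ge0; exact: P0].
have C0 : 0 <= C by exact: mulr_ge0.
under eq_integral => y _ do rewrite EFinM.
rewrite ge0_integralZl//.
- by rewrite lte_mul_pinfty.
- exact/measurable_EFinP.
- by move=> y _; rewrite lee_fin.
Qed.

(** Weak continuity is tested against vector fields, so a scalar kernel enters as a field with a
    single nonzero component, whose pointwise norm is |k|. *)
Lemma in_L2_component (i : 'I_3) (k : space3 R -> R) :
  measurable_fun [set: mspace3 R] k ->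
  (\int[leb3]_y (k y ^+ 2)%:E < +oo)%E ->
  in_L2 (fun j y => if j == i then k y else 0).
Proof.
move=> mk koo; split=> [j|]; first by case: (j == i) => //; exact: measurable_cst.
have E y : (`|(vnorm (fun j y => if j == i then k y else 0) y)%:E| `^ 2)%E = (k y ^+ 2)%:E.
  rewrite abse_EFin poweR_EFin powR_mulrn// /vnorm ger0_norm ?sqrtr_ge0// sqr_sqrtr; last first.
    by apply: sumr_ge0 => j _; exact: sqr_ge0.
  by rewrite (bigD1 i)//= eqxx big1 ?addr0// => j /negbTE ->; rewrite expr0n.
rewrite /Lp_norm unlock; apply: poweR_lty.
apply: le_lt_trans koo; rewrite le_eqVlt; apply/orP; left; apply/eqP.
by apply: eq_integral => y _; exact: E.
Qed.

End kernel_L2.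

(** * Littlewood-Paley blocks *)

Section littlewood_paley_kernel.
Context {R : realType}.
Implicit Types (chi g : space3 R -> R) (v : vfield R) (q : int).

Lemma Ck_bounded_supp_scale k g (c : R) : c != 0 ->
  Ck_bounded_supp k g -> Ck_bounded_supp k (fun x => g (c *: x)).
Proof.
move=> c0 [cg [M gM]]; split; first exact: Ck_scale.
exists (M / `|c|) => x; rewrite ltr_pdivrMr ?normr_gt0// => Mx.
by apply: gM; rewrite normrZ mulrC.
Qed.

Lemma Ck_bounded_supp_sub k (f g : space3 R -> R) : Ck_bounded_supp k f ->
  Ck_bounded_supp k g -> Ck_bounded_supp k (fun x => f x - g x).
Proof.
move=> [cf [M fM]] [cg [N gN]]; split; first exact: Ck_sub.
by exists (Num.max M N) => x; rewrite gt_max => /andP[/fM -> /gN ->]; rewrite subrr.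
Qed.

Lemma test_function_bounded_supp k g : test_function g -> Ck_bounded_supp k g.
Proof.
move=> [sg /compact_bounded[M [_ gM]]]; split; first exact: sg.
exists (`|M| + 1) => x Mx; apply: contrapT => /eqP gx.
have xg : supp g x by exact: subset_closure.
have MM : M < `|M| + 1 by rewrite (le_lt_trans (ler_norm M))// ltrDl.
by have /= := gM _ MM x xg; rewrite leNgt Mx.
Qed.

Lemma lp_symbol_bounded_supp k chi q : cutoff chi -> Ck_bounded_supp k (lp_symbol chi q).
Proof.
move=> [[/(test_function_bounded_supp k) bchi _] _ _ _].
rewrite /lp_symbol; case: (q == -1) => //.
have l0 : lambda (- q) != 0 :> R by rewrite gt_eqF// lambda_gt0.
have b1 := Ck_bounded_supp_scale l0 bchi.
apply: (Ck_bounded_supp_sub _ b1).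
apply: (Ck_bounded_supp_scale l0 (g := fun x => chi (2^-1 *: x))).
by apply: Ck_bounded_supp_scale => //; rewrite invr_eq0.
Qed.

Lemma Re_inv_fourier g z :
  complex.Re (inv_fourier g z) = (2 * pi) ^- 3 * cos_int g z.
Proof.
rewrite /inv_fourier /cintegral /= mul0r subr0; congr (_ * _).
by apply: eq_Rintegral => xi _ /=; rewrite mul0r subr0.
Qed.

Lemma Im_inv_fourier g z :
  complex.Im (inv_fourier g z) = (2 * pi) ^- 3 * sin_int g z.
Proof.
rewrite /inv_fourier /cintegral /= mul0r addr0; congr (_ * _).
by apply: eq_Rintegral => xi _ /=; rewrite mul0r addr0.
Qed.

Lemma in_L2_kernel (part : R[i] -> R) g (i : 'I_3) (x : space3 R) :
  (part = @complex.Re R \/ part = @complex.Im R) -> Ck_bounded_supp 3 g ->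
  in_L2 (fun j y => if j == i then part (inv_fourier g (x - y)) else 0).
Proof.
move=> partE bg; have [K gK] := fourier_sqr_decay bg.
have [/Ck_continuous cg _] := bg.
have mpart : measurable_fun [set: mspace3 R] (fun y => part (inv_fourier g (x - y))).
  case: partE => ->.
    under eq_fun do rewrite Re_inv_fourier.
    apply: measurable_funM; first exact: measurable_cst.
    by apply: measurable_integral_mul_dot => //; exact: continuous_cos.
  under eq_fun do rewrite Im_inv_fourier.
  apply: measurable_funM; first exact: measurable_cst.
  by apply: measurable_integral_mul_dot => //; exact: continuous_sin.
apply: in_L2_component => //.
(* The bound K for [fourier_sqr] is multiplied by the square of the normalisation (2 pi)^-3; the
   square of either part is at most the squared modulus. *)
apply: (@sqr_integral_decay_lty _ (fun z => part (inv_fourier g z)) _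
  (((2 * pi) ^- 3) ^+ 2 * K)) => // z.
have := ler_wpM2l (sqr_ge0 ((2 * pi) ^- 3)) (gK z).
apply: le_trans; rewrite [leRHS]mulrCA ler_wpM2l//.
  by rewrite !mulr_ge0// addr_ge0// sqr_ge0.
rewrite /fourier_sqr; case: partE => ->; rewrite ?Re_inv_fourier ?Im_inv_fourier exprMn.
  by rewrite ler_wpM2l ?sqr_ge0// lerDl sqr_ge0.
by rewrite ler_wpM2l ?sqr_ge0// lerDr sqr_ge0.
Qed.

(** Since v is real, the real part of a block at x is an L^2 pairing of v with a kernel field
    depending only on x, which is what weak continuity controls. *)
Lemma Re_lp_block chi q v i x :
  complex.Re (lp_block chi q v i x) =
  inner v (fun j y => if j == i then
    complex.Re (inv_fourier (lp_symbol chi q) (x - y)) else 0).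
Proof.
apply: eq_Rintegral => y _; rewrite (bigD1 i)//= eqxx big1 => [|j /negbTE ->].
  case: (inv_fourier (lp_symbol chi q) (x - y)) => a b /=; ring.
by rewrite mulr0.
Qed.

Lemma Im_lp_block chi q v i x :
  complex.Im (lp_block chi q v i x) =
  inner v (fun j y => if j == i then
    complex.Im (inv_fourier (lp_symbol chi q) (x - y)) else 0).
Proof.
apply: eq_Rintegral => y _; rewrite (bigD1 i)//= eqxx big1 => [|j /negbTE ->].
  case: (inv_fourier (lp_symbol chi q) (x - y)) => a b /=; ring.
by rewrite mulr0.
Qed.

Lemma measurable_block_norm chi q T (u : R -> vfield R) : 0 < T ->
  cutoff chi -> weakly_continuous T u ->
  measurable_fun `]0, T[ (fun t => block_norm chi q +oo (u t) : \bar R).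
Proof.
move=> T0 chi_cutoff wu; apply: measurable_fun_Lnorm_pinfty; first exact: interval_open.
move=> x t tT.
have bs := lp_symbol_bounded_supp 3 q chi_cutoff.
have cpart (part : R[i] -> R) i : (part = @complex.Re R \/ part = @complex.Im R) ->
    {for t, continuous (fun t => inner (u t) (fun j y => if j == i then
    part (inv_fourier (lp_symbol chi q) (x - y)) else 0))}.
  move=> partE; have := wu _ (in_L2_kernel i x partE bs).
  (* Continuity within [0, T] is two-sided continuity at the interior time t. *)
  by move=> /(continuous_within_itvP _ T0)[+ _ _]; apply.
have cRe i : {for t, continuous (fun t => complex.Re (lp_block chi q (u t) i x))}.
  rewrite (_ : (fun t => _) = (fun t => inner (u t) (fun j y => if j == i then
    complex.Re (inv_fourier (lp_symbol chi q) (x - y)) else 0))).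
    by apply: cpart; left.
  by apply/funext => s; rewrite Re_lp_block.
have cIm i : {for t, continuous (fun t => complex.Im (lp_block chi q (u t) i x))}.
  rewrite (_ : (fun t => _) = (fun t => inner (u t) (fun j y => if j == i then
    complex.Im (inv_fourier (lp_symbol chi q) (x - y)) else 0))).
    by apply: cpart; right.
  by apply/funext => s; rewrite Im_lp_block.
apply: continuous_comp; last exact: sqrt_continuous.
apply: cvg_big => [|i _]; first exact: add_continuous.
by apply: cvgD; [exact: (cvgM (cRe i) (cRe i))|exact: (cvgM (cIm i) (cIm i))].
Qed.

End littlewood_paley_kernel.

(** * Integrability of the low-mode norm *)

Unset Implicit Arguments.

Theorem lemma4p2 (R : realType) (chi : space3 R -> R) (c0 nu T r : R)
    (u0 : vfield R) (u : R -> vfield R)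
    (chi_cutoff : cutoff chi) (c0_gt0 : 0 < c0) (nu_gt0 : 0 < nu)
    (T_gt0 : 0 < T) (r_ge1 : 1 <= r)
    (u_leray_hopf : leray_hopf nu T u0 u)
    (u_besov : lebesgue_measure.-integrable `]0, T[
       (fun t : R => besov_norm chi (2 / r - 1) +oo (u t) `^ r)%E) :
  lebesgue_measure.-integrable `]0, T[
    (fun t : R => low_mode_norm chi c0 nu (u t)).
Proof.
have [[_ [_ wu] _ _ _] _] := u_leray_hopf.
have k0 : 0 < c0 * nu by exact: mulr_gt0.
(* The majorant from [low_mode_norm_le]: its constant term is integrable because ]0, T[ has finite
   measure, the other term by the Besov hypothesis. *)
pose B t : \bar R := (1 + (1 + (c0 * nu) `^ (1 - r))%:E *
    besov_norm chi (2 / r - 1) +oo (u t) `^ r)%E.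
have T_fin : (@lebesgue_measure R `]0%R, T[%classic < +oo)%E.
  by rewrite lebesgue_measure_itv/= lte_fin T_gt0 ltry.
have iB : lebesgue_measure.-integrable `]0, T[ B.
  apply: integrableD => //; last exact: integrableZl.
  have -> : (fun=> 1%E) = EFin \o (fun _ : R => 1 : R) by [].
  apply: measurable_bounded_integrable.
  - exact: measurable_itv.
  - exact: T_fin.
  - exact: measurable_cst.
  - by exists 1; split=> // M M1 t _; rewrite normr1 ltW.
apply: (le_integrable _ _ _ iB) => //.
- apply: measurable_low_mode_norm => // q _; exact: measurable_block_norm.
- move=> t _; rewrite !gee0_abs//.
  + exact: low_mode_norm_le.
  + by rewrite adde_ge0// mule_ge0 ?poweR_ge0// lee_fin addr_ge0// powR_ge0.
  + exact: low_mode_norm_ge0.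
Qed.
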